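(* Let $n\geq t\geq 1$ be integers. The maximum number of descents that a $t$-sorted permutation in $S_n$ can have is $\left\lfloor\frac{n-t}{2}\right\rfloor$; that is, $\max\{\operatorname{des}(s^t(\mu)):\mu\in S_n\}=\left\lfloor\frac{n-t}{2}\right\rfloor$.
   Context: A permutation is a permutation of a finite set of positive integers written in one-line notation; $S_n$ is the set of permutations of $[n]=\{1,\dots,n\}$. West's stack-sorting map $s$ is defined as follows: given an input permutation $\pi=\pi_1\cdots\pi_n$, process it with an initially empty vertical stack; at each step, if the stack is empty or the next entry of the input is smaller than the entry at the top of the stack, push the next input entry onto the stack; otherwise pop the top entry of the stack and append it to the end of the output. When the output has length $n$, this output is $s(\pi)$. (E.g. $s(4162)=1426$.) $s^t$ denotes the $t$-fold composition of $s$. A permutation is $t$-sorted if it equals $s^t(\mu)$ for some permutation $\mu$. A descent of $\pi=\pi_1\cdots\pi_n$ is an index $i\in[n-1]$ with $\pi_i>\pi_{i+1}$, and $\operatorname{des}(\pi)$ is the number of descents. *)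

(* Defs.v *)
From mathcomp Require Import all_boot.

Set Implicit Arguments.
Unset Strict Implicit.
Unset Printing Implicit Defensive.

(* One-line notation: a permutation of a finite set of positive integers is
   the sequence of its entries. *)
Definition is_permutation (p : seq nat) : bool := uniq p && all (leq 1) p.

Definition in_S (n : nat) (p : seq nat) : bool := perm_eq p (iota 1 n).

(* Machine state: (remaining input, stack with its top first, output so far).
   Once the input is exhausted there is no next entry to push, so the stack is
   popped. *)
Definition stack_state : Type := (seq nat * seq nat * seq nat)%type.

Definition stack_step (c : stack_state) : stack_state :=
  let: (inp, stk, out) := c in
  match inp, stk with
  | x :: inp', [::] => (inp', [:: x], out)
  | x :: inp', y :: stk' =>
      if x < y then (inp', x :: stk, out) else (inp, stk', rcons out y)
  | [::], y :: stk' => ([::], stk', rcons out y)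
  | [::], [::] => c
  end.

(* Every entry is pushed once and popped once, so the output has length
   [size p] after exactly [2 * size p] steps. *)
Definition stack_sort (p : seq nat) : seq nat :=
  (iter (2 * size p) stack_step (p, [::], [::])).2.

Example stack_sort_4162 : stack_sort [:: 4; 1; 6; 2] = [:: 1; 4; 2; 6].
Proof. by []. Qed.

Definition t_sorted (t : nat) (p : seq nat) : Prop :=
  exists2 mu, is_permutation mu & p = iter t stack_sort mu.

(* Indices are 0-based: [i < (size p).-1] stands for the position i + 1. *)
Definition des (p : seq nat) : nat :=
  #|[set i : 'I_(size p).-1 | nth 0 p i > nth 0 p i.+1]|.

Definition is_max (A : nat -> Prop) (m : nat) : Prop :=
  A m /\ forall k, A k -> k <= m.

(* Main.v *)
Require Import Defs.
From mathcomp Require Import all_boot zify.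

(** If [m] is the largest entry of [A m B], then [s(A m B) = s(A) s(B) m].
    Hence [s^(t+1)(A m B) = s^t(s(A) s(B)) m], so passing from [t] to [t+1]
    costs one entry and no descent: the upper bound reduces to [t = 1], where
    the recursion creates at most one descent, at the junction of [s(A)] and
    [s(B)].  The bound is attained by an increasing sequence into which small
    entries [1, ..., k] are inserted, any two of them separated: each
    application of [s] moves every small entry one place to the left. *)

(** Cutting at the last occurrence of the largest entry makes the split exist for words with
    repeated entries as well. *)
Lemma max_split_ind (P : seq nat -> Prop) :
    P [::] ->
    (forall A m B, all (geq m) A -> all (gtn m) B -> P A -> P B ->
       P (A ++ m :: B)) ->
  forall p, P p.
Proof.
move=> P0 PS p.
have [k] := ubnP (size p); elim: k p => // k IHk p.
have [->//|[A [m [B [-> leA ltB]]]]] : p = [::] \/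
    exists A m B, [/\ p = A ++ m :: B, all (geq m) A & all (gtn m) B].
  elim: p {IHk} => [|x p IHp]; [by left | right].
  case: IHp => [->|[A [m [B [-> leA ltB]]]]].
    by exists [::], x, [::].
  have [le_xm|lt_mx] := leqP x m.
    by exists (x :: A), m, B; split; rewrite //= le_xm.
  exists [::], x, (A ++ m :: B); split=> //.
  rewrite all_cat /= lt_mx; apply/andP; split.
    by apply: sub_all leA => y /= le_ym; apply: leq_ltn_trans lt_mx.
  by apply: sub_all ltB => y /= lt_ym; apply: ltn_trans lt_mx.
rewrite size_cat /= => lt_pk.
by apply: PS => //; apply: IHk; lia.
Qed.

(** Inside a larger run, [p] behaves as if alone: the top of [stk] exceeds all of [p], so nothing
    below is popped, and the head of [rest], at least every entry of [p], flushes [p] before being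
    pushed. This context is what lets the induction treat [B] on top of [m]. *)
Lemma iter_stack_step p rest stk out :
    (if stk is y :: _ then all (gtn y) p else true) ->
    (if rest is x :: _ then all (geq x) p else true) ->
  iter (2 * size p) stack_step (p ++ rest, stk, out)
    = (rest, stk, out ++ stack_sort p).
Proof.
elim/max_split_ind: p rest stk out => [|A m B leA ltB IHA IHB] rest stk out.
  by rewrite muln0 cats0.
have run rest' stk' out' :
    (if stk' is y :: _ then all (gtn y) (A ++ m :: B) else true) ->
    (if rest' is x :: _ then all (geq x) (A ++ m :: B) else true) ->
    iter (2 * size (A ++ m :: B)) stack_step ((A ++ m :: B) ++ rest', stk', out')
    = (rest', stk', out' ++ rcons (stack_sort A ++ stack_sort B) m).
  move=> stkP restP.
  (* Read from the right: process [A], push [m], process [B], pop [m]. *)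
  have -> : 2 * size (A ++ m :: B) = (1 + (2 * size B + 1)) + 2 * size A.
    by rewrite size_cat /=; lia.
  rewrite iterD -catA IHA; last 2 first.
  - by case: stk' stkP => //= y stk'; rewrite all_cat => /andP[].
  - by [].
  rewrite iterD iterD.
  have -> : iter 1 stack_step ((m :: B) ++ rest', stk', out' ++ stack_sort A)
      = (B ++ rest', m :: stk', out' ++ stack_sort A).
    by case: stk' stkP => //= y stk'; rewrite all_cat /= => /and3P[_ -> _].
  rewrite IHB //; last first.
    by case: rest' restP => //= x rest'; rewrite all_cat /= => /and3P[].
  rewrite -rcons_cat -catA.
  case: rest' restP => //= x rest'; rewrite all_cat /=.
  by case/and3P=> _ le_mx _; rewrite ltnNge le_mx.
move=> stkP restP; rewrite run //.
(* The run in the empty context computes [stack_sort (A ++ m :: B)] itself. *)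
have /(congr1 snd)/= := run [::] [::] [::] isT isT.
by rewrite cats0 /stack_sort => ->.
Qed.

Lemma stack_sort_cat p q :
    (if q is x :: _ then all (geq x) p else true) ->
  stack_sort (p ++ q) = stack_sort p ++ stack_sort q.
Proof.
move=> pq; rewrite {1}/stack_sort size_cat mulnDr addnC iterD.
rewrite iter_stack_step //.
by have := @iter_stack_step q [::] [::] (stack_sort p); rewrite cats0 => ->.
Qed.

Lemma stack_sort_cons_max m p :
  all (gtn m) p -> stack_sort (m :: p) = rcons (stack_sort p) m.
Proof.
move=> ltp; rewrite {1}/stack_sort.
have -> : 2 * size (m :: p) = 1 + (2 * size p + 1) by rewrite /=; lia.
rewrite iterD iterD /=.
by have := @iter_stack_step p [::] [:: m] [::]; rewrite cats0 => ->.
Qed.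

Lemma stack_sort_max A m B : all (geq m) A -> all (gtn m) B ->
  stack_sort (A ++ m :: B) = rcons (stack_sort A ++ stack_sort B) m.
Proof.
move=> leA ltB; rewrite stack_sort_cat //.
by rewrite stack_sort_cons_max // rcons_cat.
Qed.

Lemma perm_stack_sort p : perm_eq (stack_sort p) p.
Proof.
elim/max_split_ind: p => // A m B leA ltB IHA IHB.
rewrite stack_sort_max // perm_rcons perm_sym perm_catC /= perm_cons.
by rewrite perm_catC perm_sym perm_cat.
Qed.

Lemma perm_iter_stack_sort t p : perm_eq (iter t stack_sort p) p.
Proof.
by elim: t => //= t IHt; apply: perm_trans (perm_stack_sort _) IHt.
Qed.

Lemma iter_stack_sort_rcons t p m : all (geq m) p ->
  iter t stack_sort (rcons p m) = rcons (iter t stack_sort p) m.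
Proof.
move=> lep; elim: t => //= t ->; rewrite -cats1 stack_sort_max ?cats0 //.
by rewrite (perm_all _ (perm_iter_stack_sort t p)).
Qed.

Lemma des_small p : size p <= 1 -> des p = 0.
Proof.
move=> p_le1; apply: eq_card0 => i.
by have := ltn_ord i; lia.
Qed.

Lemma des_cons x y p : des [:: x, y & p] = (y < x) + des (y :: p).
Proof.
have desE q : des q = \sum_(i < (size q).-1) (nth 0 q i.+1 < nth 0 q i).
  rewrite /des -sum1_card big_mkcond.
  by apply: eq_bigr => i _; rewrite inE; case: (_ < _).
by rewrite !desE big_ord_recl.
Qed.

Lemma des_cat_cons p x y q :
  des (rcons p x ++ y :: q) = des (rcons p x) + (y < x) + des (y :: q).
Proof.
elim: p => [|z [|z' p] IHp].
- by rewrite des_cons (@des_small [:: x]).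
- by rewrite /= !des_cons (@des_small [:: x]) // addn0 addnA.
- by move: IHp; rewrite /= !des_cons => ->; rewrite !addnA.
Qed.

Lemma des_rcons_max p m : all (geq m) p -> des (rcons p m) = des p.
Proof.
case/lastP: p => [|p x]; first by rewrite !des_small.
rewrite all_rcons -[rcons (rcons p x) m]cats1 des_cat_cons => /andP[/= le_xm _].
by rewrite ltnNge le_xm (@des_small [:: m]) // !addn0.
Qed.

Lemma des_cat_le p q : des (p ++ q) <= (des p + des q).+1.
Proof.
case/lastP: p => [|p x]; first by rewrite cat0s; lia.
case: q => [|y q]; first by rewrite cats0; lia.
by rewrite des_cat_cons; case: (y < x); lia.
Qed.

Lemma des_stack_sort p : (des (stack_sort p)).*2 <= (size p).-1.
Proof.
elim/max_split_ind: p => [|A m B leA ltB IHA IHB]; first by rewrite des_small.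
have leB : all (geq m) B by apply: sub_all ltB => y /ltnW.
rewrite stack_sort_max // des_rcons_max; last first.
  by rewrite all_cat !(perm_all _ (perm_stack_sort _)) leA.
rewrite size_cat /= addnS /=.
(* An empty side leaves no junction; otherwise [(size A - 1) + (size B - 1) + 2] still fits under
   [size A + size B]. *)
case: A leA IHA => [|a A] leA IHA; first exact: leq_trans IHB (leq_pred _).
case: B ltB leB IHB => [|b B] ltB leB IHB.
  by rewrite cats0 addn0; apply: leq_trans IHA (leq_pred _).
have := des_cat_le (stack_sort (a :: A)) (stack_sort (b :: B)).
move: IHA IHB => /=; lia.
Qed.

Lemma des_iter_stack_sort t p :
  (des (iter t.+1 stack_sort p)).*2 <= size p - t.+1.
Proof.
elim: t p => [|t IHt] p; first by rewrite subn1; apply: des_stack_sort.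
elim/max_split_ind: p => [|A m B leA ltB _ _].
  by rewrite des_small // (perm_size (perm_iter_stack_sort _ _)).
have leB : all (geq m) B by apply: sub_all ltB => y /ltnW.
have leAB : all (geq m) (stack_sort A ++ stack_sort B).
  by rewrite all_cat !(perm_all _ (perm_stack_sort _)) leA.
rewrite iterSr stack_sort_max // iter_stack_sort_rcons // des_rcons_max; last first.
  by rewrite (perm_all _ (perm_iter_stack_sort _ _)).
apply: leq_trans (IHt _) _.
by rewrite !size_cat !(perm_size (perm_stack_sort _)) /=; lia.
Qed.

Fixpoint zigzag a b k : seq nat :=
  if k is k'.+1 then [:: a, b & zigzag a.+1 b.+1 k'] else [::].

Lemma perm_zigzag a b k : perm_eq (zigzag a b k) (iota b k ++ iota a k).
Proof.
elim: k a b => //= k IHk a b.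
rewrite -[[:: a, b & _]]/([:: a] ++ [:: b] ++ _) perm_catCA /= perm_cons perm_sym.
rewrite -(cat1s a (iota _ _)) perm_catCA /= perm_cons perm_sym.
exact: IHk.
Qed.

(** Each block [a.+1, b] is sorted to [b, a.+1] on its own, since the next entry is larger than
    both. The entry [a] in front then pairs with [b], and [a.+1] becomes the front entry for the
    rest. *)
Lemma stack_sort_zigzag a b k r : b + k <= a.+1 ->
  a :: stack_sort (zigzag a.+1 b k ++ iota (a + k).+1 r)
    = zigzag a b k ++ iota (a + k) r.+1.
Proof.
elim: k a b => [|k IHk] a b le_ba.
  rewrite addn0 /=; congr cons.
  elim: r a {le_ba} => // r IHr a /=.
  rewrite -cat1s stack_sort_cat ?IHr //.
  by case: r {IHr} => //= r; rewrite leqnSn.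
rewrite -addSnnS -[RHS]/([:: a, b & zigzag a.+1 b.+1 k ++ iota (a.+1 + k) r.+1]).
rewrite -IHk; last by lia.
rewrite -[zigzag a.+1 b k.+1 ++ _]/([:: a.+1; b] ++ (zigzag a.+2 b.+1 k ++ _)).
rewrite stack_sort_cat; last first.
  by case: k {IHk} le_ba => [|k] /=; [case: r => //= r|]; rewrite ?andbT; lia.
by rewrite stack_sort_cons_max //= andbT; lia.
Qed.

(** The last entry of the leading run supplies the front entry of [stack_sort_zigzag], so one pass
    moves one unit of length from the leading run to the trailing one. *)
Lemma stack_sort_iota_zigzag a b m k r : b + k <= a.+1 ->
  stack_sort (iota a m.+1 ++ zigzag (a + m.+1) b k ++ iota (a + m.+1 + k) r)
    = iota a m ++ zigzag (a + m) b k ++ iota (a + m + k) r.+1.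
Proof.
elim: m a => [|m IHm] a le_ba.
  rewrite addn0 addn1 -stack_sort_zigzag //= -cat1s stack_sort_cat //.
  by case: k {le_ba} => [|k] /=; [case: r => //= r|]; rewrite ?andbT; lia.
rewrite -[iota a m.+2]/([:: a] ++ iota a.+1 m.+1) -catA stack_sort_cat; last first.
  by rewrite /= leqnSn.
by rewrite -!(addSnnS a) IHm //; lia.
Qed.

Lemma iter_stack_sort_zigzag a b t k r : b + k <= a.+1 ->
  iter t stack_sort (iota a t ++ zigzag (a + t) b k ++ iota (a + t + k) r)
    = zigzag a b k ++ iota (a + k) (r + t).
Proof.
move=> le_ba; elim: t r => [|t IHt] r; first by rewrite !addn0.
by rewrite iterSr stack_sort_iota_zigzag // IHt addSnnS.
Qed.

Lemma des_zigzag_ge a b k q : b + k <= a -> k <= des (zigzag a b k ++ q).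
Proof.
elim: k a b => //= k IHk a b le_ba; rewrite des_cons.
have -> : b < a by lia.
have := IHk a.+1 b.+1 _; rewrite addSnnS add1n ltnS => /(_ (leqW le_ba)).
case: (zigzag _ _ _ ++ q) => [|x p]; first by rewrite !des_small.
by rewrite (des_cons b) => /leq_trans-> //; apply: leq_addl.
Qed.

Theorem theorem2 (n t : nat) (ht : 1 <= t) (htn : t <= n) :
  is_max (fun d => exists p, [/\ in_S n p, t_sorted t p & d = des p])
         ((n - t) %/ 2)
  /\
  is_max (fun d => exists mu, in_S n mu /\ d = des (iter t stack_sort mu))
         ((n - t) %/ 2).
Proof.
have upper mu : size mu = n -> des (iter t stack_sort mu) <= (n - t) %/ 2.
  by case: t ht {htn} => // u _ <-; have := des_iter_stack_sort u mu; lia.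
(* The remainder [r] is 0 or 1, according to the parity of [n - t]. The small entries are 1 to [k];
   the [t] leading entries of [mu] are used up by the [t] passes. *)
set k := (n - t) %/ 2; set r := n - t - k.*2.
pose mu := iota k.+1 t ++ zigzag (k.+1 + t) 1 k ++ iota (k.+1 + t + k) r.
have mu_perm : in_S n mu.
  have -> : n = k + (t + (k + r)) by rewrite /r /k; lia.
  rewrite /in_S /mu !iotaD !add1n perm_sym perm_catCA perm_cat2l catA perm_cat2r.
  by rewrite perm_sym perm_zigzag.
have size_S p : in_S n p -> size p = n by move/perm_size->; rewrite size_iota.
have des_mu : des (iter t stack_sort mu) = k.
  (* Counting the descents inside the [k] pairs suffices, as [upper] gives the other inequality. *)
  apply/eqP; rewrite eqn_leq upper ?size_S //=.
  by rewrite /mu iter_stack_sort_zigzag ?des_zigzag_ge.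
split; split=> [|d].
- exists (iter t stack_sort mu); split=> //.
    by apply: perm_trans mu_perm; apply: perm_iter_stack_sort.
  exists mu => //; rewrite /is_permutation (perm_uniq mu_perm) iota_uniq.
  by rewrite (perm_all _ mu_perm); apply/allP => i; rewrite mem_iota => /andP[].
- case=> p [pS [nu _ def_p] ->]; rewrite def_p upper //.
  (* The preimage [nu] need not be given in [S_n]; its length is [n] because sorting preserves
     length. *)
  by rewrite -(perm_size (perm_iter_stack_sort t nu)) -def_p size_S.
- by exists mu.
- by case=> nu [nuS ->]; rewrite upper ?size_S.
Qed.
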